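(* Let $\alpha\in\mathbb{R}$ be irrational of finite type $\eta$, and let $\epsilon=\epsilon_R>0$ be a function of $R>0$ such that $\epsilon=o(R^{-1-\eta})$ as $R\to\infty$. Then there exists $R_0>0$ such that for all $R>R_0$, $$S_\alpha(\epsilon,R)=0.$$
   Context: An irrational $\alpha\in\mathbb{R}$ is said to be of finite type $\eta$ (a real number) if there exists a constant $c=c(\alpha)>0$ such that $\left|\alpha-\frac pq\right|>\frac{c}{q^{1+\eta}}$ for all pairs $(p,q)\in\mathbb{Z}\times\mathbb{Z}_{>0}$ (necessarily $\eta\ge1$ by Dirichlet's theorem). For $\alpha\in\mathbb{R}$, $\epsilon>0$, $R>0$ let $$\mathrm{Sect}_{\alpha,\epsilon}(R):=\{(x,y)\in\mathbb{R}_{>0}\times\mathbb{R}:\ x^2+y^2\le R^2,\ \alpha-\epsilon<y/x<\alpha+\epsilon\}$$ and $$S_\alpha(\epsilon,R):=\#\left(\mathbb{Z}^2\cap \mathrm{Sect}_{\alpha,\epsilon}(R)\right)=\#\{(m,n)\in\mathbb{Z}_{>0}\times\mathbb{Z}: m^2+n^2\le R^2,\ |n-\alpha m|<m\epsilon\}.$$ *)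

(* Defs.v *)
From HB Require Import structures.
From mathcomp Require Import all_boot all_order all_algebra.
From mathcomp Require Import finmap zify.
From mathcomp Require Import all_classical all_reals all_analysis.
Set Implicit Arguments.
Unset Strict Implicit.
Unset Printing Implicit Defensive.
Import Order.TTheory GRing.Theory Num.Theory.
Import numFieldNormedType.Exports.
Local Open Scope classical_set_scope.
Local Open Scope ring_scope.

(* [=o_] takes a packed filter, and the library does not pack [+oo]. *)
Canonical pinfty_nbhs_filter_on (R : numFieldType) :=
  FilterType (+oo_R) (@filter_filter _ _ (@proper_pinfty_nbhs R)).

Definition finite_type (R : realType) (alpha eta : R) : Prop :=
  exists2 c : R, 0 < c &
    forall p q : int, 0 < q ->
      `|alpha - p%:~R / q%:~R| > c / (q%:~R `^ (1 + eta)).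

Definition Sect (R : realType) (alpha eps r : R) : set (R * R) :=
  [set z | [/\ 0 < z.1, z.1 ^+ 2 + z.2 ^+ 2 <= r ^+ 2,
               alpha - eps < z.2 / z.1 & z.2 / z.1 < alpha + eps]].

Definition lattice (R : realType) : set (R * R) :=
  [set` Num.int] `*` [set` Num.int].

(* [fset_set] sends infinite sets to the empty one; this never happens here,
   by [finite_lattice_Sect] below. *)
Definition Scount (R : realType) (alpha eps r : R) : nat :=
  #|` fset_set (@lattice R `&` Sect alpha eps r)|.

Lemma finite_lattice_Sect (R : realType) (alpha eps r : R) :
  finite_set (@lattice R `&` Sect alpha eps r).
Proof.
pose N := (Num.truncn (r ^+ 2)).+1.
pose f (k : nat) : R := (k%:Z - N%:Z)%:~R.
have fin : finite_set (f @` `I_(N + N).+1) by exact/finite_image/finite_II.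
apply: sub_finite_set (finite_setX fin fin).
have key (x : R) : x \is a Num.int -> x ^+ 2 <= r ^+ 2 ->
    (f @` `I_(N + N).+1) x.
  move=> /intrP[m ->] mr.
  have mN : (`|m| < N)%N.
    rewrite -(ltr_nat R) natr_absz.
    apply: le_lt_trans (truncnS_gt _); apply: le_trans mr.
    rewrite -rmorphXn ler_int; nia.
  exists (absz (m + N%:Z)); first by rewrite /=; lia.
  rewrite /f; congr (_%:~R); lia.
move=> [x y] /= [[/= xi yi]] [/= _ xyr _ _].
split=> /=; apply: key => //; apply: le_trans xyr.
- by rewrite lerDl sqr_ge0.
- by rewrite lerDr sqr_ge0.
Qed.

(* Main.v *)
Require Import Defs.
From HB Require Import structures.
From mathcomp Require Import all_boot all_order all_algebra.
From mathcomp Require Import all_classical all_reals all_analysis.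
Set Implicit Arguments.
Unset Strict Implicit.
Unset Printing Implicit Defensive.
Import Order.TTheory GRing.Theory Num.Theory.
Import numFieldNormedType.Exports.
Local Open Scope classical_set_scope.
Local Open Scope ring_scope.

(** A lattice point [(m, n)] of the sector gives a fraction [n / m] with
    [0 < m <= r] that lies within [eps r] of [alpha].  The type condition keeps such a
    fraction at a distance greater than [c / m `^ (1 + eta)], and this is at
    least [c * r `^ (- 1 - eta)] because the exponent [1 + eta] is nonnegative
    ([finite_type_exponent_ge0]).  As [eps = o(r `^ (- 1 - eta))], the
    half-width [eps r] is eventually below that distance, and the sector then contains no
    lattice point ([Scount_eq0]). *)

(** If the exponent were negative, [c / q `^ (1 + eta)] would tend to infinity
    with [q], whereas every real is within [1] of some fraction of
    denominator [q].  This is a crude form of Dirichlet's bound [1 <= eta]; it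
    makes [m `^ (1 + eta)] nondecreasing in [m]. *)
Lemma finite_type_exponent_ge0 (R : realType) (alpha eta : R) :
  finite_type alpha eta -> 0 <= 1 + eta.
Proof.
move=> [c c0 h]; rewrite leNgt; apply/negP => s0.
set s := - (1 + eta); have sp : 0 < s by rewrite oppr_gt0.
(* The denominator is chosen so that [q `^ s >= c^-1]. *)
pose q : int := Posz (Num.truncn (c^-1 `^ s^-1)).+1.
have q0 : 0 < q by [].
have qR0 : 0 < q%:~R :> R by rewrite ltr0z.
have qR1 : 1 <= q%:~R :> R by rewrite ler1z.
have := h (Num.floor (alpha * q%:~R)) q q0; apply/negP; rewrite -leNgt.
have cq : 1 <= c / q%:~R `^ (1 + eta).
  rewrite -powRN -/s -ler_pdivrMl // mulr1.
  rewrite [leLHS](_ : _ = (c^-1 `^ s^-1) `^ s); last first.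
    by rewrite -powRrM mulVf ?gt_eqF // powRr1 // invr_ge0 ltW.
  apply: ge0_ler_powR; rewrite ?nnegrE ?powR_ge0 ?(ltW sp) ?(ltW qR0) //.
  by rewrite -pmulrn; exact/ltW/truncnS_gt.
apply: le_trans cq.
have -> : alpha - (Num.floor (alpha * q%:~R))%:~R / q%:~R
        = (alpha * q%:~R - (Num.floor (alpha * q%:~R))%:~R) / q%:~R.
  by rewrite mulrBl mulfK // gt_eqF.
rewrite normrM normfV (gtr0_norm qR0) ler_pdivrMr // mul1r.
rewrite ger0_norm ?subr_ge0 ?floor_le //.
apply: le_trans qR1; rewrite lerBlDl; apply/ltW.
by have := floorD1_gt (alpha * q%:~R); rewrite intrD.
Qed.

Lemma Scount_eq0 (R : realType) (alpha eta c eps r : R) :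
    (forall p q : int, 0 < q ->
      `|alpha - p%:~R / q%:~R| > c / (q%:~R `^ (1 + eta))) ->
    0 <= 1 + eta -> 0 < c -> 0 < r -> eps <= c * r `^ (- 1 - eta) ->
  Scount alpha eps r = 0%N.
Proof.
move=> h s0 c0 r0 epsr; rewrite /Scount.
suff -> : @lattice R `&` Sect alpha eps r = set0.
  by rewrite fset_set0 finmap.cardfs0.
rewrite -subset0 => -[x y] /= [[/= /intrP[m ->] /intrP[n ->]]].
move=> [/= m0 mnr lo up].
have mr : m%:~R <= r.
  rewrite -ler_sqr ?nnegrE ?(ltW m0) ?(ltW r0) //.
  by apply: le_trans mnr; rewrite lerDl sqr_ge0.
have := h n m; rewrite -(ltr0z R) => /(_ m0); apply/negP; rewrite -leNgt.
apply: (@le_trans _ _ eps).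
  by rewrite distrC ler_distl (ltW lo) (ltW up).
apply: le_trans epsr _; rewrite ler_pM2l // -opprD powRN.
rewrite lef_pV2 ?posrE ?powR_gt0 //.
by apply: ge0_ler_powR; rewrite ?nnegrE ?(ltW m0) ?(ltW r0).
Qed.

Theorem proposition1p7 (R : realType) (alpha eta : R)
  (alpha_irrational : irrational alpha)
  (alpha_type : finite_type alpha eta)
  (eps : R -> R)
  (eps_gt0 : forall r : R, 0 < r -> 0 < eps r)
  (eps_littleo : eps =o_ (+oo_R) (fun r : R => r `^ (- 1 - eta))) :
  exists2 r0 : R, 0 < r0 & forall r : R, r0 < r -> Scount alpha (eps r) r = 0%N.
Proof.
have s0 := finite_type_exponent_ge0 alpha_type.
have [c c0 h] := alpha_type.
have /eqoP/(_ c c0)[M [_ HM]] := eps_littleo.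
exists (Num.max M 1); first by rewrite lt_max ltr01 orbT.
move=> r; rewrite gt_max => /andP[Mr r1]; have r0 := lt_trans ltr01 r1.
apply: (Scount_eq0 h) => //.
have := HM r Mr; rewrite /= (ger0_norm (powR_ge0 _ _)).
exact/le_trans/ler_norm.
Qed.
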